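(* Let $p$ be a prime, let $n \geq 2$ be an integer, let $H$ be an abelian group with $|H| = p^{n-1}$, and let $G := \mathrm{C}_{p} \times H$ (an abelian $p$-group of order $p^{n}$). Then for any prime $q$, it holds that $q \in S(G)$ if and only if $q^{p-1} \equiv 1 \pmod{p^{n}}$.
   Context: $\mathrm{C}_{m}$ denotes the cyclic group of order $m$. For a finite group $G$, let $x_{g}$ be a variable for each $g \in G$. The group determinant of $G$ is $\Theta_{G}(x_{g}) := \det (x_{g h^{-1}})_{g, h \in G} \in \mathbb{Z}[x_{g}]$, where $\mathbb{Z}[x_g]$ is the polynomial ring over $\mathbb{Z}$ in the variables $x_g$, $g \in G$. The set of integer group determinants of $G$ is $S(G) := \{ \Theta_{G}(a_{g}) \mid a_{g} \in \mathbb{Z} \text{ for all } g \in G \}$, i.e. the set of all values taken by $\Theta_G$ when the variables are given arbitrary integer values. Primes are positive. *)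

(* Defs.v *)
From HB Require Import structures.
From mathcomp Require Export all_boot all_order all_fingroup all_algebra all_solvable.
From mathcomp.multinomials Require Export mpoly.

Set Implicit Arguments.
Unset Strict Implicit.
Unset Printing Implicit Defensive.

Import GRing.Theory.
Local Open Scope ring_scope.

(* The variables x_g, and the rows and columns of the matrix, are numbered by
   'I_#|G| through the enumeration of G: the variable x_g is
   'X_(enum_rank_in (group1 G) g). The second argument of enum_rank_in is
   always an element of G below, so the default index is never used. *)
Definition group_det (gT : finGroupType) (G : {group gT}) : {mpoly int[#|G|]} :=
  \det (\matrix_(i < #|G|, j < #|G|)
          'X_(enum_rank_in (group1 G) (enum_val i * (enum_val j)^-1)%g)).

(* Only the values of a on G matter. *)
Definition is_int_group_det (gT : finGroupType) (G : {group gT}) (d : int) : Prop :=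
  exists a : gT -> int, d = (group_det G).@[fun i => a (enum_val i)].

(* Main.v *)
From HB Require Import structures.
Require Import Defs.
From mathcomp Require Import zify ring.

(** For a finite group K and an integral function x on K, viewed as an element
    of the group ring Z[K], let N_K(x) be the determinant of the matrix
    (x(g h^-1)) of multiplication by x, and let aug x be the sum of the values
    of x. The values N_K(x) are the integer group determinants of K.

    Necessity. Let G = C_p x H, let a be in Z[G] and let b in Z[H] be its image
    under the projection G -> H. Functions constant along C_p form a direct
    summand of Z[G] that is stable under a and on which a acts as b, so N_H(b)
    divides N_G(a) ([fdet_proj_dvd]). The main point is the congruence
      N_G(a) = N_H(b)^p   modulo p^n = p |H|   ([fdet_circ_mod]).
    In the basis of the binomial functions i |-> 'C(i, j) on Z/p, translations
    are unitriangular modulo p; hence, up to a unimodular factor, the matrix of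
    a has the form T + p D, where T is block triangular with p diagonal blocks
    equal to the matrix of b. Both T and D are invariant under H, and for
    matrices invariant under a free action of a p-group of order p^m one has
    det (T + p D) = det T modulo p^(m+1) ([fdet_add_pmul]): in the expansion of
    the left hand side, a term containing k > 0 factors p has a stabiliser of
    order p^v at most k, so v < k, and its orbit contributes a multiple of
    p^(m - v) p^k.
    If N_G(a) = q is prime, then N_H(b) is 1, -1, q or -q, and the congruence
    reads q = +-1 or q = +-q^p modulo p^n. A comparison modulo p settles the
    sign, and modulo p^2 it excludes q = p ([pow_congr_of_dvd]).

    Sufficiency. Let K be any abelian group of order p^n, and let S be the sum
    of its elements. One constructs x and y in Z[K], with aug x in a prescribed
    class prime to p, such that x y = 1 + k S for some integer k
    ([unit_pair_exists]); in terms of characters, the nontrivial ones take x to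
    units. The construction descends along a chain of subgroups C, each of
    index p in the previous one, and realises such a pair in Z[K/C]; at each
    step a p-power of the pair is constant modulo p, which allows it to be
    glued with the cyclotomic unit 1 + t + ... + t^(c-1). Now suppose that
    q^(p-1) = 1 modulo p^n and aug x = q modulo p. Then aug (x^(p^n)) = q
    modulo p^n, and adding a multiple of S to x^(p^n) makes its augmentation
    equal to q. As augmentations divide norms and the norm of 1 + k S is
    its augmentation, the norm of the resulting element is q or -q; for odd p
    it is q because the norm and the augmentation agree modulo p. For p = 2 the
    element 1 + k S with q = 1 + k 2^n does it. *)

Set Implicit Arguments.
Unset Strict Implicit.
Unset Printing Implicit Defensive.

Import GRing.Theory Num.Theory.
Local Open Scope ring_scope.

(** * Determinants indexed by a finite type *)

Section Fdet.
Variable R : comNzRingType.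

Definition fmx (I : finType) (A : I -> I -> R) : 'M[R]_#|I| :=
  \matrix_(i, j) A (enum_val i) (enum_val j).

Definition fdet (I : finType) (A : I -> I -> R) : R := \det (fmx A).

Lemma eq_fdet (I : finType) (A B : I -> I -> R) :
  (forall i j, A i j = B i j) -> fdet A = fdet B.
Proof. by move=> AB; congr (\det _); apply/matrixP=> i j; rewrite !mxE. Qed.

Lemma fdet_ord (I : finType) n (f : 'I_n -> I) (A : I -> I -> R) :
  bijective f -> fdet A = \det (\matrix_(i, j) A (f i) (f j)).
Proof.
move=> bf; have En : n = #|I| by rewrite -(bij_eq_card bf) card_ord.
subst n.
have inj_s : injective (fun i => enum_rank (f i)).
  by move=> i j /enum_rank_inj /(bij_inj bf).
pose s := perm inj_s.
have -> : \matrix_(i, j) A (f i) (f j) = row_perm s (col_perm s (fmx A)).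
  by apply/matrixP=> i j; rewrite !mxE !permE !enum_rankK.
rewrite row_permE col_permE !det_mulmx !det_perm odd_permV mulrA mulrC mulrA.
by rewrite -signr_addb addbb mul1r.
Qed.

Lemma fmxM (I : finType) (A B : I -> I -> R) :
  fmx A *m fmx B = fmx (fun i j => \sum_k A i k * B k j).
Proof.
apply/matrixP=> i j; rewrite !mxE (reindex _ (onW_bij _ (enum_val_bij I))).
by apply: eq_bigr => k _; rewrite !mxE.
Qed.

Lemma fdetM (I : finType) (A B : I -> I -> R) :
  fdet A * fdet B = fdet (fun i j => \sum_k A i k * B k j).
Proof. by rewrite -det_mulmx fmxM. Qed.

Lemma fdet_void (I : finType) (A : I -> I -> R) : #|I| = 0%N -> fdet A = 1.
Proof.
rewrite /fdet; move: (fmx A); move: #|I| => n M n0; subst n; exact: det_mx00.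
Qed.

Lemma fdet_id (I : finType) : fdet (fun i j : I => (i == j)%:R) = 1.
Proof.
rewrite -[RHS](det1 _ #|I|); congr (\det _); apply/matrixP=> i j.
by rewrite !mxE (inj_eq enum_val_inj).
Qed.

(** Induction on [p]: an enumeration of ['I_p.+1 * J] that lists the block over
    [ord0] first makes the matrix block triangular of size two by two. *)
Lemma fdet_block_trig p (J : finType) (A : 'I_p * J -> 'I_p * J -> R) :
    (forall (i j : 'I_p) x y, (j < i)%N -> A (i, x) (j, y) = 0) ->
  fdet A = \prod_(l < p) fdet (fun x y => A (l, x) (l, y)).
Proof.
elim: p A => [|p IHp] A trigA.
  by rewrite big_ord0 fdet_void // card_prod card_ord.
pose f (k : 'I_(#|J| + #|{: 'I_p * J}|)) : 'I_p.+1 * J :=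
  match split k with
  | inl x => (ord0, enum_val x)
  | inr y => let: (l, x) := enum_val y in (lift ord0 l, x)
  end.
have inj_f : injective f.
  move=> k1 k2; rewrite -[k1]splitK -[k2]splitK /f !unsplitK.
  case: (split k1) => [x1|y1]; case: (split k2) => [x2|y2].
  - by case=> /enum_val_inj->.
  - by case: (enum_val y2).
  - by case: (enum_val y1).
  case E1: (enum_val y1) => [l1 z1]; case E2: (enum_val y2) => [l2 z2].
  move=> E; have El := lift_inj (congr1 fst E); have /= Ez := congr1 snd E.
  by congr (unsplit (inr _)); apply: enum_val_inj; rewrite E1 E2 El Ez.
have bij_f : bijective f.
  apply: inj_card_bij inj_f _.
  by rewrite card_ord !card_prod !card_ord mulSn.
rewrite (fdet_ord A bij_f) big_ord_recl.
rewrite -(IHp (fun u v => A (lift ord0 u.1, u.2) (lift ord0 v.1, v.2))); last first.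
  by move=> i j x y lt_ji; apply: trigA.
rewrite /fdet -(det_ublock _ (\matrix_(x, y)
   A (ord0, enum_val x) (lift ord0 (enum_val y).1, (enum_val y).2))).
congr (\det _); rewrite -[LHS]submxK; congr block_mx; apply/matrixP=> i j;
  rewrite !mxE /f ?(unsplitK (inl _)) ?(unsplitK (inr _)) //.
- by case: (enum_val j).
- by case: (enum_val i) => l x; exact: trigA.
by case: (enum_val i); case: (enum_val j).
Qed.

End Fdet.

(** * Determinants of matrices invariant under a free action of a p-group *)

Lemma dvdz_sum (I : finType) (P : pred I) (F : I -> int) (d : int) :
  (forall i, P i -> (d %| F i)%Z) -> (d %| \sum_(i | P i) F i)%Z.
Proof. by move=> dF; apply: (big_ind (fun x => (d %| x)%Z)) => // x y; exact: rpredD. Qed.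

Lemma dvdz_sum_orbit (gT : finGroupType) (X : finType)
    (to : {action gT &-> X}) (P : {set X}) (F : X -> int) (d : int) :
    [acts [set: gT], on P | to] ->
    (forall x g, F (to x g) = F x) ->
    (forall x, x \in P -> (d %| #|orbit to [set: gT] x|%:Z * F x)%Z) ->
  (d %| \sum_(x in P) F x)%Z.
Proof.
move=> actP FJ dF; rewrite (set_partition_big _ (orbit_partition actP)) /=.
apply: dvdz_sum => O /imsetP[x Px ->].
rewrite (eq_bigr (fun=> F x)); last by move=> _ /orbitP[g _ <-].
by rewrite sumr_const -mulr_natl natz dF.
Qed.

Section DetCongruence.

Variables (gT : finGroupType) (N : nat) (to : {action gT &-> 'I_N}).

Definition perm_set_act (x : 'S_N * {set 'I_N}) (g : gT) :=
  (x.1 ^ actperm to g, setact to x.2 g)%g.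

Lemma perm_set_act1 x : perm_set_act x 1%g = x.
Proof.
case: x => s S; rewrite /perm_set_act /= (morph1 (actperm_morphism to)) conjg1.
by rewrite (act1 (to^*)%act).
Qed.

Lemma perm_set_actM x g h :
  perm_set_act x (g * h)%g = perm_set_act (perm_set_act x g) h.
Proof.
case: x => s S; rewrite /perm_set_act /=; congr (_, _).
  by rewrite actpermM ?inE // conjgM.
by rewrite [LHS](actM (to^*)%act).
Qed.

Canonical perm_set_action := TotalAction perm_set_act1 perm_set_actM.

Variables (p m : nat) (A B : 'M[int]_N).
Hypothesis p_prime : prime p.
Hypothesis card_gT : #|gT| = (p ^ m)%N.
Hypothesis to_free : forall i g, to i g = i -> g = 1%g.
Hypothesis AJ : forall i j g, A (to i g) (to j g) = A i j.
Hypothesis BJ : forall i j g, B (to i g) (to j g) = B i j.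

(** The pairs (permutation [s], set [S]) index the terms of the expansion of
    \det (A + p B): the rows in [S] take their entry from [p B], the others
    from [A]. *)
Definition pterm (x : 'S_N * {set 'I_N}) : int :=
  (-1) ^+ x.1 * \prod_i (if i \in x.2 then p%:Z * B i (x.1 i) else A i (x.1 i)).

Lemma pterm_act x g : pterm (perm_set_act x g) = pterm x.
Proof.
case: x => s S; rewrite /pterm /perm_set_act /= odd_permJ; congr (_ * _).
rewrite (reindex_inj (act_inj to g)) /=; apply: eq_bigr => i _.
have -> : (s ^ actperm to g)%g (to i g) = to (s i) g.
  by rewrite -[to i g](actpermE to g) permJ actpermE.
by rewrite AJ BJ (mem_imset _ _ (act_inj to g)).
Qed.

(** The stabiliser of [(s, S)] maps [S] to itself freely, so its order [p ^ v]
    is at most [#|S|], and [v < p ^ v <= #|S|]. The orbit has [p ^ (m - v)]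
    elements and the term contains the factor [p ^ #|S|]. *)
Lemma dvd_pterm x : x.2 != set0 ->
  (p%:Z ^+ m.+1 %| #|orbit perm_set_action [set: gT] x|%:Z * pterm x)%Z.
Proof.
case: x => s S /= /set0Pn[i0 Si0].
set x := (s, S); set O := orbit _ _ _.
have cardO := card_orbit_stab perm_set_action [set: gT] x.
rewrite cardsT card_gT -/O in cardO.
set K := ('C_[set: gT][x | perm_set_action])%g in cardO.
have leK : (#|K| <= #|S|)%N.
  (* The stabiliser embeds in S through g |-> to i0 g. *)
  rewrite -(@card_in_imset _ _ (to i0) (mem K)); last first.
    move=> g h _ _ E; apply/eqP; rewrite eq_mulgV1; apply/eqP/(to_free (i := i0)).
    by rewrite actM E actK.
  apply/subset_leq_card/subsetP=> _ /imsetP[g Kg ->].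
  have [_ <-] : perm_set_act x g = x by move: Kg; rewrite !inE sub1set inE => /andP[_ /eqP].
  by rewrite /= (mem_imset _ _ (act_inj to g)).
have /(dvdn_pfactor _ _ p_prime)[v le_vm EK] : (#|K| %| p ^ m)%N.
  by rewrite -cardO dvdn_mull.
have EO : #|O| = (p ^ (m - v))%N.
  apply/eqP; rewrite -(@eqn_pmul2r #|K|) ?cardO; last by rewrite EK expn_gt0 prime_gt0.
  by rewrite EK -expnD subnK.
have dS : (p%:Z ^+ #|S| %| pterm x)%Z.
  rewrite dvdz_mull // (bigID (mem S)) /= dvdz_mulr //.
  rewrite -prodr_const.
  apply: (big_ind2 (fun a b => (a %| b)%Z)) => //.
    by move=> a b c d; exact: dvdz_mul.
  by move=> i Si; rewrite /= Si dvdz_mulr.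
apply: dvdz_trans (dvdz_mul (dvdzz _) dS).
rewrite EO -[(_ ^ _)%N%:Z]natz natrX natz -exprD dvdz_exp2l //.
have := ltn_expl v (prime_gt1 p_prime); rewrite -EK; lia.
Qed.

(** The terms with [S] empty add up to [\det A]; the remaining ones are summed
    orbit by orbit. *)
Lemma det_add_pmul : (p%:Z ^+ m.+1 %| \det (A + p%:Z *: B) - \det A)%Z.
Proof.
have -> : \det (A + p%:Z *: B) = \sum_(s : 'S_N) \sum_(S : {set 'I_N}) pterm (s, S).
  apply: eq_bigr => s _; rewrite /pterm /= -mulr_sumr; congr (_ * _).
  transitivity (\prod_i (p%:Z * B i (s i) + A i (s i))).
    by apply: eq_bigr => i _; rewrite !mxE addrC.
  exact: bigA_distr.
rewrite pair_bigA /= (eq_bigr pterm); last by case.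
rewrite (bigID (fun x : 'S_N * {set 'I_N} => x.2 == set0)) /=.
have -> : \sum_(x : 'S_N * {set 'I_N} | x.2 == set0) pterm x = \det A.
  rewrite (eq_bigl (fun x : 'S_N * {set 'I_N} => true && (x.2 == set0))) //.
  rewrite -(pair_big xpredT (pred1 set0) (fun s S => pterm (s, S))) /=.
  apply: eq_bigr => s _; rewrite big_pred1_eq /pterm /=; congr (_ * _).
  by apply: eq_bigr => i _; rewrite inE.
rewrite addrC addrK.
rewrite (eq_bigl (mem [set x : 'S_N * {set 'I_N} | x.2 != set0])); last first.
  by move=> x; rewrite !inE.
apply: (dvdz_sum_orbit (to := perm_set_action)).
- apply/actsP=> g _ x; rewrite !inE /= /setact.
  by rewrite -!card_gt0 card_imset //; exact: act_inj.
- exact: pterm_act.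
by move=> x; rewrite inE; exact: dvd_pterm.
Qed.

End DetCongruence.

Lemma fdet_add_pmul (gT : finGroupType) (I : finType) (to : I -> gT -> I)
    (p m : nat) (A B : I -> I -> int) :
    prime p -> #|gT| = (p ^ m)%N ->
    (forall i, to i 1%g = i) -> (forall i g h, to i (g * h)%g = to (to i g) h) ->
    (forall i g, to i g = i -> g = 1%g) ->
    (forall i j g, A (to i g) (to j g) = A i j) ->
    (forall i j g, B (to i g) (to j g) = B i j) ->
  (p%:Z ^+ m.+1 %| fdet (fun i j => A i j + p%:Z * B i j) - fdet A)%Z.
Proof.
move=> p_prime card_gT to1 toM to_free AJ BJ.
pose act (i : 'I_#|I|) g := enum_rank (to (enum_val i) g).
have act1 i : act i 1%g = i by rewrite /act to1 enum_valK.
have actM i g h : act i (g * h)%g = act (act i g) h by rewrite /act toM enum_rankK.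
have := @det_add_pmul gT _ (TotalAction act1 actM) p m (fmx A) (fmx B) p_prime card_gT.
have -> : fmx A + p%:Z *: fmx B = fmx (fun i j => A i j + p%:Z * B i j).
  by apply/matrixP=> i j; rewrite !mxE.
apply=> [i g /= /(congr1 enum_val)|i j g|i j g].
- by rewrite enum_rankK; exact: to_free.
- by rewrite !mxE /= !enum_rankK.
by rewrite !mxE /= !enum_rankK.
Qed.

(** * The group matrix of a product with a cyclic group of order p *)

Lemma bin_add_prime p r j : prime p -> (j < p)%N ->
  exists d, 'C(p + r, j) = ('C(r, j) + p * d)%N.
Proof.
move=> p_prime lt_jp.
rewrite -binomial.Vandermonde big_ord_recl bin0 mul1n subn0.
suff /dvdnP[d ->] : (p %| \sum_(i < j) 'C(p, bump 0 i) * 'C(r, j - bump 0 i))%N.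
  by exists d; rewrite (mulnC d).
apply: dvdn_sum => i _; rewrite dvdn_mulr // prime_dvd_bin //= /bump /=.
by rewrite add1n (leq_ltn_trans _ lt_jp) ?ltn_ord.
Qed.

(** For [j < p] the function i |-> 'C(i, j) is p-periodic modulo [p]; hence it
    is well defined on Z/p with values modulo [p]. *)
Lemma bin_mod_prime p (i m j : 'I_p) : prime p ->
  exists d, 'C(i + m, j) = ('C((i + m) %% p, j) + p * d)%N.
Proof.
move=> p_prime; case: (ltnP (i + m) p) => [lt_p|le_p].
  by exists 0%N; rewrite modn_small // muln0 addn0.
have [d Ed] := bin_add_prime (i + m - p) p_prime (ltn_ord j).
exists d; rewrite -(subnK le_p) modnDr [X in 'C(X, j) = _]addnC Ed modn_small //.
have := ltn_ord i; have := ltn_ord m; lia.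
Qed.

Lemma Vandermonde_ord p (i m j : 'I_p) :
  (\sum_(k < p | k <= j) 'C(i, k) * 'C(m, j - k) = 'C(i + m, j))%N.
Proof.
by rewrite -binomial.Vandermonde (big_ord_widen p (fun k => 'C(i, k) * 'C(m, j - k))%N).
Qed.

Section Circulant.

Variables (p' : nat) (J : finGroupType) (a : 'I_p'.+2 -> J -> int).
Local Notation p := p'.+2.
Hypothesis p_prime : prime p.

Definition circ (u v : 'I_p * J) : int := a (u.1 - v.1) (u.2 * v.2^-1)%g.
Definition proj (x : J) : int := \sum_i a i x.

(** The columns of [pascal] are the binomial functions on Z/p, tensored with
    the identity of the group ring of [J]. [circ_pascal] is the product of
    [circ] and [pascal] ([circ_mul_pascal]), and [circ_trig] is the block
    triangular matrix that describes [circ] in the basis [pascal] modulo [p]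
    ([pascal_mul_trig]). *)
Definition pascal (u v : 'I_p * J) : int := 'C(u.1, v.1)%:Z * (u.2 == v.2)%:Z.
Definition circ_pascal (u v : 'I_p * J) : int :=
  \sum_m a (- m) (u.2 * v.2^-1)%g * 'C((u.1 + m) %% p, v.1)%:Z.
Definition circ_trig (u v : 'I_p * J) : int :=
  if (u.1 <= v.1)%N
  then \sum_(m < p) a (- m) (u.2 * v.2^-1)%g * 'C(m, v.1 - u.1)%:Z else 0.

Lemma sum_delta_r (F : J -> int) y : \sum_x F x * (x == y)%:Z = F y.
Proof.
rewrite (bigD1 y) //= eqxx mulr1 big1 ?addr0 // => x /negPf->.
by rewrite mulr0.
Qed.

Lemma sum_delta_l (F : J -> int) y : \sum_x (y == x)%:Z * F x = F y.
Proof. by rewrite -[RHS]sum_delta_r; apply: eq_bigr => x _; rewrite mulrC eq_sym. Qed.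

Lemma circ_mul_pascal u v : \sum_w circ u w * pascal w v = circ_pascal u v.
Proof.
rewrite -(pair_bigA _ (fun k z => circ u (k, z) * pascal (k, z) v)) /=.
rewrite /circ_pascal (reindex_inj (addrI u.1)) /=; apply: eq_bigr => m _.
rewrite /circ /pascal /=.
rewrite (eq_bigr (fun z => a (u.1 - (u.1 + m)) (u.2 * z^-1)%g *
                            'C((u.1 + m) %% p, v.1)%:Z * (z == v.2)%:Z)).
  by rewrite sum_delta_r opprD addrA subrr add0r.
by move=> z _; rewrite mulrA.
Qed.

(** The change of 'C(i + m, j) when [i + m] is reduced modulo [p], divided by [p]. *)
Definition carry (i m j : 'I_p) : nat :=
  (('C(i + m, j) - 'C((i + m) %% p, j)) %/ p)%N.

Lemma carryE (i m j : 'I_p) :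
  ('C(i + m, j) = 'C((i + m) %% p, j) + p * carry i m j)%N.
Proof.
by have [d Ed] := bin_mod_prime i m j p_prime; rewrite /carry Ed addKn mulKn.
Qed.

Definition circ_carry (u v : 'I_p * J) : int :=
  \sum_m a (- m) (u.2 * v.2^-1)%g * (carry u.1 m v.1)%:Z.

(** By the Vandermonde identity, translating 'C(_, j) by [m] gives the
    combination of the 'C(_, k) with coefficients 'C(m, j - k), up to [p]
    times the carry of [i + m]. *)
Lemma pascal_mul_trig u v :
  \sum_w pascal u w * circ_trig w v = circ_pascal u v + p%:Z * circ_carry u v.
Proof.
rewrite -(pair_bigA _ (fun k z => pascal u (k, z) * circ_trig (k, z) v)) /=.
transitivity (\sum_(k < p) \sum_(m < p) (if (k <= v.1)%N then
    a (- m) (u.2 * v.2^-1)%g * ('C(u.1, k) * 'C(m, v.1 - k))%N%:Z else 0)).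
  apply: eq_bigr => k _; rewrite /pascal /circ_trig /=.
  case: (k <= v.1)%N; last first.
    by rewrite [LHS]big1 ?[RHS]big1 // => z _; rewrite mulr0.
  rewrite (eq_bigr (fun z => (u.2 == z)%:Z * ('C(u.1, k)%:Z *
    \sum_(m < p) a (- m) (z * v.2^-1)%g * 'C(m, v.1 - k)%:Z))); last first.
    by move=> z _; rewrite mulrCA mulrA.
  rewrite sum_delta_l mulr_sumr; apply: eq_bigr => m _.
  by rewrite PoszM mulrCA.
rewrite exchange_big /= /circ_pascal /circ_carry mulr_sumr -big_split /=.
apply: eq_bigr => m _; rewrite -big_mkcond /= -mulr_sumr mulrCA -mulrDr; congr (_ * _).
rewrite -PoszM -PoszD -(carryE u.1 m v.1) -Vandermonde_ord.
by rewrite (big_morph Posz PoszD (erefl _)).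
Qed.

Lemma fdet_pascal : fdet pascal = 1.
Proof.
have -> : fdet pascal = fdet (fun u v => pascal v u).
  by rewrite /fdet -det_tr; congr (\det _); apply/matrixP=> i j; rewrite !mxE.
rewrite fdet_block_trig => [|i j x y lt_ji]; last first.
  by rewrite /pascal /= bin_small ?mul0r.
rewrite big1 // => l _; rewrite -[RHS](fdet_id _ J); apply: eq_fdet => x y.
by rewrite /pascal /= binn mul1r eq_sym natz.
Qed.

Lemma fdet_trig : fdet circ_trig = fdet (fun x y => proj (x * y^-1)%g) ^+ p.
Proof.
rewrite fdet_block_trig => [|i j x y lt_ji]; last by rewrite /circ_trig /= leqNgt lt_ji.
transitivity (\prod_(l < p) fdet (fun x y => proj (x * y^-1)%g)); last first.
  by rewrite prodr_const card_ord.
apply: eq_bigr => l _.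
apply: eq_fdet => x y; rewrite /circ_trig leqnn subnn /proj [RHS](reindex_inj oppr_inj).
by apply: eq_bigr => m _; rewrite bin0 mulr1.
Qed.

(** [circ_pascal] has the determinant of [circ], and [circ_pascal + p circ_carry]
    that of [circ_trig], because [pascal] is unimodular; right translations by
    [J] leave both [circ_pascal] and [circ_carry] invariant. *)
Lemma fdet_circ_mod m : #|J| = (p ^ m)%N ->
  (p%:Z ^+ m.+1 %| fdet (fun x y => proj (x * y^-1)%g) ^+ p - fdet circ)%Z.
Proof.
move=> cardJ; pose to (u : 'I_p * J) g := (u.1, u.2 * g)%g.
have := @fdet_add_pmul J _ to p m circ_pascal circ_carry p_prime cardJ.
have -> : fdet (fun u v => circ_pascal u v + p%:Z * circ_carry u v) = fdet circ_trig.
  rewrite -[RHS]mul1r -fdet_pascal fdetM; apply: eq_fdet => u v.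
  by rewrite pascal_mul_trig.
have -> : fdet circ_pascal = fdet circ.
  rewrite -[RHS]mulr1 -fdet_pascal fdetM; apply: eq_fdet => u v.
  by rewrite circ_mul_pascal.
have E (x y g : J) : (x * g * (y * g)^-1 = x * y^-1)%g.
  by rewrite invMg mulgA mulgK.
rewrite fdet_trig; apply.
- by case=> i x; rewrite /to mulg1.
- by case=> i x g h; rewrite /to mulgA.
- by case=> i x g [E1]; apply: (mulgI x); rewrite E1 mulg1.
- by move=> u v g; rewrite /circ_pascal /to /= E.
by move=> u v g; rewrite /circ_carry /to /= E.
Qed.

(** The binomial function for [j = 0] is constant, so the first block column of
    [circ_pascal] consists of copies of the matrix of [proj], which can be
    factored out on the right as the first block of [D]. *)
Lemma fdet_proj_dvd : (fdet (fun x y => proj (x * y^-1)%g) %| fdet circ)%Z.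
Proof.
pose D (u v : 'I_p * J) : int :=
  if u.1 == v.1 then if v.1 == 0 then proj (u.2 * v.2^-1)%g else (u.2 == v.2)%:Z else 0.
pose Y (u v : 'I_p * J) : int :=
  if v.1 == 0 then (u.2 == v.2)%:Z else circ_pascal u v.
have <- : fdet D = fdet (fun x y => proj (x * y^-1)%g).
  rewrite fdet_block_trig => [|i j x y lt_ji]; last first.
    by rewrite /D /= -val_eqE /= gtn_eqF.
  rewrite (bigD1 0) //= big1 ?mulr1 => [|i i0]; last first.
    rewrite -[RHS](fdet_id _ J); apply: eq_fdet => x y.
    by rewrite /D /= eqxx (negPf i0) natz.
  by apply: eq_fdet => x y; rewrite /D /=.
suff -> : fdet circ = fdet Y * fdet D by exact: dvdz_mull.
rewrite -[LHS]mulr1 -fdet_pascal !fdetM; apply: eq_fdet => u v.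
rewrite circ_mul_pascal -(pair_bigA _ (fun k z => Y u (k, z) * D (k, z) v)) /=.
rewrite (bigD1 v.1) //= [X in _ + X]big1 ?addr0 => [|k kv]; last first.
  by rewrite big1 // => z _; rewrite /D /= (negPf kv) mulr0.
rewrite /D /Y /= eqxx; case: eqP => [v0|_].
  rewrite sum_delta_l /circ_pascal /proj v0 (reindex_inj oppr_inj).
  by apply: eq_bigr => m _; rewrite opprK bin0 mulr1.
by rewrite (sum_delta_r (fun z => circ_pascal u (v.1, z))); case: v.
Qed.

End Circulant.

(** * The necessary condition *)

Lemma eqn_mod_dvdz m k d : (m = k %[mod d])%N <-> (d%:Z %| m%:Z - k%:Z)%Z.
Proof.
by rewrite -eqz_mod_dvd !modz_nat; split=> [->|/eqP[]].
Qed.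

Lemma dvdz_exprS_sub p k (u v : int) :
  prime p -> (p%:Z %| u - v)%Z -> (p%:Z ^+ k.+1 %| u ^+ (p ^ k) - v ^+ (p ^ k))%Z.
Proof.
move=> p_prime /dvdzP[d0 Ed]; elim: k => [|k /dvdzP[d Ek]].
  by rewrite expn0 !expr1 Ed dvdz_mull.
rewrite expnSr !exprM; move: (u ^+ _) (v ^+ _) Ek => {u d0 Ed} u w /eqP.
rewrite subr_eq => /eqP->; rewrite [_ + w]addrC exprDn big_ord_recl.
rewrite bin0 subn0 mulr1 addrAC subrr add0r /=.
apply: dvdz_sum => i _; rewrite /bump /= add1n -mulr_natl natz.
have [Ei|lt_ip] : i.+1 = p \/ (i.+1 < p)%N by have := ltn_ord i; lia.
  rewrite Ei subnn mul1r binn mul1r exprMn -exprM dvdz_mull //.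
  by apply: dvdz_exp2l; have := prime_gt1 p_prime; nia.
rewrite mulrCA dvdz_mull // [(p%:Z ^+ k.+2)]exprS dvdz_mul //.
  by rewrite dvdzE /= prime_dvd_bin.
by rewrite exprS -mulrA mulrCA dvdz_mulr.
Qed.

Lemma dvdz_expr_prime_sub p (u : int) : prime p -> (p%:Z %| u ^+ p - u)%Z.
Proof.
move=> p_prime.
have Fermat m : (p%:Z %| m%:Z ^+ p - m%:Z)%Z.
  by have /eqn_mod_dvdz := fermat_little m p_prime; rewrite -natz natrX natz.
case: (intP u) => [|m|m]; first exact: (Fermat 0%N).
  exact: Fermat.
have [p2|p_odd] := even_prime p_prime.
  rewrite p2 sqrrN; have := Fermat m.+1; rewrite p2 => /(rpredD (dvdz_mulr m.+1 (dvdzz 2))).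
  by congr (_ %| _)%Z; ring.
by rewrite exprNn -signr_odd p_odd expr1 mulN1r -opprD rpredN.
Qed.

Lemma dvdz_prime_abs q (N : int) : prime q -> (N %| q%:Z)%Z ->
  [\/ N = 1, N = -1, N = q%:Z | N = - q%:Z].
Proof.
move=> q_prime; rewrite dvdzE /= => /(primeP q_prime).2 /orP[] /eqP; case: N => N /=.
- by move=> ->; constructor 1.
- by case=> ->; constructor 2.
- by move=> ->; constructor 3.
by move=> <-; constructor 4; rewrite NegzE.
Qed.

(** [N] is [d] or [d * q] with [d ^+ 2 = 1]. In the first case [q] is congruent
    to [d ^+ p], whose power of exponent [p - 1] is 1. In the second case
    [q = p] is impossible modulo [p ^ 2], and for odd [p] the congruence of [N]
    and [q] modulo [p] forces [d = 1]. *)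
Lemma pow_congr_of_dvd p n q (N : int) :
    prime p -> (2 <= n)%N -> prime q -> (N %| q%:Z)%Z ->
    (p%:Z ^+ n %| N ^+ p - q%:Z)%Z ->
  (q ^ (p - 1) = 1 %[mod p ^ n])%N.
Proof.
move=> p_prime n2 q_prime dvNq dvpn.
apply/eqn_mod_dvdz; rewrite -[(_ ^ (_ - 1))%N%:Z]natz natrX natz.
have dvX : ((p ^ n)%N%:Z = p%:Z ^+ n) by rewrite -natz natrX natz.
rewrite dvX.
have p2n : (p%:Z ^+ 2 %| p%:Z ^+ n)%Z by apply: dvdz_exp2l.
have Ep : p = (p - 1).+1 by rewrite subn1 prednK ?prime_gt0.
have p1n : (p%:Z %| p%:Z ^+ n)%Z by rewrite -[X in (X %| _)%Z]expr1 dvdz_exp2l //; lia.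
have NFq : (p%:Z %| N - q%:Z)%Z.
  have := rpredB (dvdz_trans p1n dvpn) (dvdz_expr_prime_sub N p_prime).
  by congr (_ %| _)%Z; ring.
have [d d2 [EN|EN]] : exists2 d : int, d ^+ 2 = 1 & N = d \/ N = d * q%:Z.
- case: (dvdz_prime_abs q_prime dvNq) => ->.
  + by exists 1; [|left].
  + by exists (-1); [|left].
  + by exists 1; [|right; rewrite mul1r].
  by exists (-1); [|right; rewrite mulN1r].
- have d1 : (d ^+ p) ^+ (p - 1) = 1.
    have [->|p_odd] := even_prime p_prime; first by rewrite d2.
    have -> : (p - 1 = 2 * (p - 1)./2)%N by rewrite mul2n even_halfK // oddB ?p_odd ?prime_gt0.
    by rewrite exprAC [d ^+ (2 * _)]exprM d2 !expr1n.
  rewrite -opprB rpredN EN in dvpn; rewrite -[X in _ - X]d1.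
  by rewrite subrXX dvdz_mulr.
(* If q = p, then p ^ 2 divides both N ^+ p and N ^+ p - p. *)
have cpq : coprimez p%:Z q%:Z.
  rewrite /coprimez /= /gcdz /= eqz_nat -/(coprime p q) prime_coprime // dvdn_prime2 //.
  apply/eqP=> Eq; rewrite EN -Eq exprMn in dvpn.
  have dvp : (p%:Z ^+ 2 %| d ^+ p * p%:Z ^+ p)%Z.
    by rewrite dvdz_mull // dvdz_exp2l ?prime_gt1.
  have := rpredB dvp (dvdz_trans p2n dvpn); rewrite opprB addrC subrK.
  rewrite dvdzE abszX /= => /(dvdn_leq (prime_gt0 p_prime)).
  by rewrite leqNgt -[X in (X < _)%N]expn1 ltn_exp2l ?prime_gt1.
have dp : d ^+ p = 1.
  have [->|p_odd] := even_prime p_prime; first by [].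
  have [->|d1] : d = 1 \/ d = -1 by move/eqP: d2; rewrite sqrf_eq1 => /orP[] /eqP->; [left|right].
    by rewrite expr1n.
  have : (p%:Z %| 2 * q%:Z)%Z by move: NFq; rewrite EN d1 -rpredN; congr (_ %| _)%Z; ring.
  rewrite Gauss_dvdzl // dvdzE /= dvdn_prime2 // => /eqP p2.
  by rewrite p2 in p_odd.
move: dvpn; rewrite EN exprMn dp mul1r {1}Ep exprSr -[X in _ - X]mul1r -mulrBl.
by rewrite Gauss_dvdzl // coprimezXl.
Qed.

(** The value of the group determinant can be computed with any enumeration
    [e] of the group in place of the one by ordinals. *)
Lemma group_det_fdet (gT : finGroupType) (G : {group gT}) (a : gT -> int)
    (I : finType) (e : I -> gT) :
    injective e -> e @: I = G ->
  (group_det G).@[fun i => a (enum_val i)] = fdet (fun i j => a (e i * (e j)^-1)%g).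
Proof.
move=> inj_e im_e.
have Ge i : e i \in G by rewrite -im_e imset_f.
have inj_r : injective (fun i => enum_rank_in (group1 G) (e i)).
  by move=> i j /(congr1 enum_val); rewrite !enum_rankK_in // => /inj_e.
have cardI : #|I| = #|G| by rewrite -im_e card_imset.
have [f rK fK] : bijective (fun i => enum_rank_in (group1 G) (e i)).
  by apply: inj_card_bij inj_r _; rewrite card_ord cardI.
have Ef k : e (f k) = enum_val k by rewrite -[in RHS](fK k) enum_rankK_in.
rewrite (fdet_ord _ (f := f)); last by exists (fun i => enum_rank_in (group1 G) (e i)).
rewrite -det_map_mx; congr (\det _); apply/matrixP=> i j; rewrite !mxE /= mevalXU.
by rewrite !Ef enum_rankK_in // groupM ?groupV ?enum_valP.
Qed.

Lemma group_det_prime_congr (p n : nat) (hT : finGroupType) (H : {group hT})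
    (q : nat) :
    prime p -> (2 <= n)%N -> #|H| = (p ^ (n - 1))%N -> prime q ->
  is_int_group_det (setX_group (Zp_group p) H) q%:Z ->
  (q ^ (p - 1) = 1 %[mod p ^ n])%N.
Proof.
move=> p_prime n2 cardH q_prime.
case: p p_prime cardH => [|[|p']] // p_pr cardH [a].
pose e (u : 'I_p'.+2 * subg_of H) : 'Z_p'.+2 * hT := (u.1, sgval u.2).
rewrite (@group_det_fdet _ _ a _ e); first last.
- apply/setP=> -[i x]; rewrite !inE /=; apply/imsetP/idP.
    by move=> [[j y] _ [_ ->]]; exact: subgP.
  by move=> Hx; exists (i, subg H x) => //; rewrite /e /= subgK.
- by move=> [i x] [j y] [] /= -> /val_inj ->.
have -> : fdet (fun i j => a (e i * (e j)^-1)%g) =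
    fdet (circ (fun i (x : subg_of H) => a (i, sgval x))).
  by apply: eq_fdet => u v.
move=> Eq.
have cardJ : #|{: subg_of H}| = (p'.+2 ^ (n - 1))%N.
  by rewrite card_sub /= -cardH; apply: eq_card => x; rewrite inE.
apply: (pow_congr_of_dvd p_pr n2 q_prime).
  by rewrite Eq; exact: fdet_proj_dvd.
have := fdet_circ_mod (fun i (x : subg_of H) => a (i, sgval x)) p_pr cardJ.
by rewrite -Eq subn1 prednK ?(ltnW n2).
Qed.

(** * The integral group ring of a finite abelian group *)

(** The proof of commutativity is a parameter of the type, so that the group
    ring is a commutative ring by inference. *)
Definition group_ring (K : finGroupType) (KC : commutative (@mulg K)) : Type :=
  {ffun K -> int}.

Section GroupRing.

Variables (K : finGroupType) (KC : commutative (@mulg K)).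
Local Notation A := (group_ring KC).

HB.instance Definition _ := GRing.Zmodule.copy A {ffun K -> int}.

Definition gone : A := [ffun g => (g == 1%g)%:Z].
Definition gmul (x y : A) : A :=
  [ffun g => \sum_h (x : {ffun K -> int}) (g * h^-1)%g * (y : {ffun K -> int}) h].

Lemma gmulC : commutative gmul.
Proof.
move=> x y; apply/ffunP=> g; rewrite !ffunE.
rewrite (reindex_inj (h := fun h => h^-1 * g)%g) /=; last first.
  by move=> h k /mulIg/invg_inj.
by apply: eq_bigr => h _; rewrite invMg invgK mulKVg KC mulrC.
Qed.

Lemma gmulA : associative gmul.
Proof.
move=> x y z; apply/ffunP=> g; rewrite !ffunE.
transitivity (\sum_h \sum_k (x : {ffun K -> int}) (g * h^-1)%g *
    ((y : {ffun K -> int}) (h * k^-1)%g * (z : {ffun K -> int}) k)).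
  by apply: eq_bigr => h _; rewrite ffunE mulr_sumr.
rewrite exchange_big; apply: eq_bigr => k _; rewrite ffunE mulr_suml.
rewrite (reindex_inj (mulIg k)) /=; apply: eq_bigr => h _.
by rewrite mulgK invMg mulgA mulrA; congr (x _ * _ * _); rewrite -!mulgA [(k^-1 * _)%g]KC.
Qed.

Lemma gmul1 : left_id gone gmul.
Proof.
move=> x; apply/ffunP=> g; rewrite ffunE (bigD1 g) //= big1 ?addr0 => [|h hg].
  by rewrite ffunE mulgV eqxx mul1r.
by rewrite ffunE -eq_mulgV1 eq_sym (negPf hg) mul0r.
Qed.

Lemma gmulDl : left_distributive gmul +%R.
Proof.
move=> x y z; apply/ffunP=> g; rewrite !ffunE -big_split; apply: eq_bigr => h _ /=.
by rewrite ffunE mulrDl.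
Qed.

Lemma gone_neq0 : gone != 0.
Proof. by apply/eqP=> /ffunP/(_ 1%g); rewrite !ffunE eqxx. Qed.

HB.instance Definition _ :=
  GRing.Zmodule_isComNzRing.Build A gmulA gmulC gmul1 gmulDl gone_neq0.

Definition coef (x : A) (g : K) : int := (x : {ffun K -> int}) g.

Lemma coefP (x y : A) : coef x =1 coef y -> x = y.
Proof. by move=> xy; apply/ffunP. Qed.

Lemma coefD x y g : coef (x + y) g = coef x g + coef y g.
Proof. by rewrite /coef ffunE. Qed.

Lemma coef_sum (I : Type) (r : seq I) (P : pred I) (F : I -> A) g :
  coef (\sum_(i <- r | P i) F i) g = \sum_(i <- r | P i) coef (F i) g.
Proof.
by apply: (big_morph (fun x => coef x g)) => [x y|]; [exact: coefD|rewrite /coef ffunE].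
Qed.

Lemma coefM (x y : A) g : coef (x * y) g = \sum_h coef x (g * h^-1)%g * coef y h.
Proof. by rewrite /coef ffunE. Qed.

Lemma coef1 g : coef 1 g = (g == 1%g)%:Z.
Proof. by rewrite /coef ffunE. Qed.

Definition aug (x : A) : int := \sum_g coef x g.

Lemma aug_additive : zmod_morphism aug.
Proof.
move=> x y; rewrite /aug -sumrB; apply: eq_bigr => g _.
by rewrite /coef !ffunE.
Qed.

Lemma aug_multiplicative : monoid_morphism aug.
Proof.
split=> [|x y]; rewrite /aug.
  rewrite (bigD1 1%g) //= coef1 eqxx big1 ?addr0 // => g g1.
  by rewrite coef1 (negPf g1).
under eq_bigr do rewrite coefM.
rewrite exchange_big mulr_sumr; apply: eq_bigr => h _; rewrite -mulr_suml; congr (_ * _).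
rewrite (reindex_inj (mulIg h)); apply: eq_bigr => g _; by rewrite mulgK.
Qed.

HB.instance Definition _ := GRing.isZmodMorphism.Build A int aug aug_additive.
HB.instance Definition _ := GRing.isMonoidMorphism.Build A int aug aug_multiplicative.

Lemma coef_intmul (k : int) x g : coef (k%:~R * x) g = k * coef x g.
Proof.
rewrite mulrzl /coef.
have E n : coef (x *+ n) g = n%:Z * coef x g.
  by rewrite /coef ffunMnE -mulr_natl natz.
by case: k => n; rewrite ?NegzE ?mulrNz -?pmulrn ?mulNr -E // /coef ffunE.
Qed.

Definition gelt (g : K) : A := [ffun h => (h == g)%:Z].

Lemma coef_gelt g h : coef (gelt g) h = (h == g)%:Z.
Proof. by rewrite /coef ffunE. Qed.

Lemma gelt1 : gelt 1%g = 1. Proof. by []. Qed.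

Lemma geltM g h : gelt (g * h)%g = gelt g * gelt h.
Proof.
apply: coefP => k; rewrite coefM (bigD1 h) //= big1 ?addr0 => [|l lh].
  by rewrite !coef_gelt eqxx mulr1 -[in RHS](inj_eq (mulIg h)) mulgKV.
by rewrite !coef_gelt (negPf lh) mulr0.
Qed.

Lemma geltX g n : gelt (g ^+ n)%g = gelt g ^+ n.
Proof. by elim: n => [|n IHn]; rewrite ?expg0 ?gelt1 // expgS exprS geltM IHn. Qed.

Lemma aug_gelt g : aug (gelt g) = 1.
Proof.
rewrite /aug (bigD1 g) //= coef_gelt eqxx big1 ?addr0 // => h hg.
by rewrite coef_gelt (negPf hg).
Qed.

Lemma gring_sum_gelt x : x = \sum_g (coef x g)%:~R * gelt g.
Proof.
apply: coefP => h; rewrite coef_sum (bigD1 h) //= coef_intmul coef_gelt eqxx mulr1.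
by rewrite big1 ?addr0 // => g gh; rewrite coef_intmul coef_gelt eq_sym (negPf gh) mulr0.
Qed.

Definition gsum (C : {set K}) : A := \sum_(g in C) gelt g.

Lemma coef_gsumT g : coef (gsum setT) g = 1.
Proof.
rewrite coef_sum (bigD1 g) ?inE //= coef_gelt eqxx big1 ?addr0 // => h /andP[_ hg].
by rewrite coef_gelt eq_sym (negPf hg).
Qed.

Lemma aug_gsum (C : {set K}) : aug (gsum C) = #|C|%:Z.
Proof.
rewrite rmorph_sum /= (eq_bigr (fun=> 1)) ?sumr_const ?natz // => g _.
by rewrite aug_gelt.
Qed.

Lemma mulr_gsumT x : x * gsum setT = (aug x)%:~R * gsum setT.
Proof.
apply: coefP => g; rewrite coefM coef_intmul coef_gsumT mulr1 /aug.
rewrite [RHS](reindex_inj (h := fun h => g * h^-1)%g) /=; last by move=> h k /mulgI/invg_inj.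
by apply: eq_bigr => h _; rewrite coef_gsumT mulr1.
Qed.

Lemma gsumT_div (p : nat) z (k : int) : prime p ->
  p%:R * z = k%:~R * gsum setT -> z = (k %/ p)%Z%:~R * gsum setT.
Proof.
move=> p_prime E.
have pE : (p%:R : A) = (p%:Z)%:~R by rewrite pmulrn.
have p0 : p%:Z != 0 by rewrite eqz_nat -lt0n prime_gt0.
apply: coefP => g; have /(congr1 (coef^~ g)) := E.
rewrite pE !coef_intmul coef_gsumT !mulr1 => <-.
by rewrite mulKz.
Qed.

End GroupRing.

(** * The norm of a group ring element *)

(** The vector [1] is an eigenvector for [s]; applying the adjugate to
    [M *m 1 = s *: 1] expresses [\det M] as a multiple of [s]. *)
Lemma dvdz_fdet_row_sum (I : finType) (A : I -> I -> int) (s : int) :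
  (0 < #|I|)%N -> (forall i, \sum_j A i j = s) -> (s %| fdet A)%Z.
Proof.
rewrite /fdet => I0 As.
have {As} : forall i, \sum_j fmx A i j = s.
  move=> i; rewrite -(As (enum_val i)) (reindex _ (onW_bij _ (enum_val_bij I))).
  by apply: eq_bigr => j _; rewrite mxE.
move: (fmx A) I0; move: #|I| => n M; case: n M => // n M _ Ms.
have /matrixP/(_ ord0 ord0) : \adj M *m (M *m const_mx 1) =
    (\det M)%:M *m (const_mx 1 : 'cV_n.+1).
  by rewrite mulmxA mul_adj_mx.
rewrite mul_scalar_mx !mxE mulr1 => <-; apply: dvdz_sum => i _; apply: dvdz_mull.
rewrite mxE (eq_bigr (M i)) ?Ms // => j _; by rewrite mxE mulr1.
Qed.

(** An instance of det (1 + c r) = det (1 + r c), for a column [c] and a row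
    [r]; the identity follows from two factorisations of one block matrix. *)
Lemma det_add_const (R : comNzRingType) n (k : R) :
  \det (1%:M + const_mx k : 'M[R]_n) = 1 + k *+ n.
Proof.
pose r : 'rV[R]_n := const_mx k; pose c : 'cV[R]_n := const_mx 1.
have Ecr : c *m r = const_mx k.
  by apply/matrixP=> i j; rewrite !mxE big_ord1 !mxE mul1r.
have Erc : r *m c = (k *+ n)%:M.
  apply/matrixP=> i j; rewrite !mxE !ord1 eqxx mulr1n.
  by rewrite (eq_bigr (fun=> k)) ?sumr_const ?card_ord // => l _; rewrite !mxE mulr1.
have E : block_mx 1%:M 0 c 1%:M *m block_mx 1%:M (- r) 0 (1%:M + c *m r)
       = block_mx (1%:M + r *m c) (- r) 0 1%:M *m block_mx 1%:M 0 c 1%:M.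
  rewrite !mulmx_block !mul1mx !mulmx1 !mul0mx !mulmx0 !add0r !addr0 mulmxN mulNmx addrK.
  by rewrite addrCA addNr addr0.
have := congr1 determinant E.
rewrite !det_mulmx !det_lblock !det_ublock !det1 !mulr1 !mul1r Ecr Erc => ->.
by rewrite -raddfD /= det_scalar1.
Qed.

Section Norm.
Variables (K : finGroupType) (KC : commutative (@mulg K)).
Local Notation A := (group_ring KC).

Definition gnorm (x : A) : int := fdet (fun g h => coef x (g * h^-1)%g).

Lemma gnormM x y : gnorm (x * y) = gnorm x * gnorm y.
Proof.
rewrite /gnorm fdetM; apply: eq_fdet => g h.
rewrite coefM [RHS](reindex_inj (mulIg h)) /=; apply: eq_bigr => k _.
by rewrite mulgK invMg mulgA.
Qed.

Lemma aug_dvd_gnorm x : (aug x %| gnorm x)%Z.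
Proof.
apply: dvdz_fdet_row_sum => [|g]; first by apply/card_gt0P; exists 1%g.
rewrite (reindex_inj (h := fun h => h^-1 * g)%g) /=; last by move=> h k /mulIg/invg_inj.
by apply: eq_bigr => h _; rewrite invMg invgK mulKVg.
Qed.

Lemma gnorm_add_gsumT (k : int) : gnorm (1 + k%:~R * gsum KC setT) = 1 + k * #|K|%:Z.
Proof.
have -> : k * #|K|%:Z = k *+ #|K| by rewrite -mulr_natr natz.
rewrite -det_add_const; congr (\det _).
apply/matrixP=> i j; rewrite !mxE coefD coef1 coef_intmul coef_gsumT mulr1.
by rewrite -eq_mulgV1 (inj_eq enum_val_inj) natz.
Qed.

Lemma gnorm_int (k : int) : gnorm (k%:~R : A) = k ^+ #|K|.
Proof.
rewrite -det_scalar; congr (\det _); apply/matrixP=> i j.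
rewrite -[_%:~R]mulr1 !mxE coef_intmul coef1 -eq_mulgV1 (inj_eq enum_val_inj).
by case: eqP => _; rewrite ?mulr1 ?mulr0.
Qed.

(** Right translations act freely on the rows and columns of a group matrix. *)
Lemma gnorm_add_pmul (p m : nat) (x d : A) : prime p -> #|K| = (p ^ m)%N ->
  (p%:Z ^+ m.+1 %| gnorm (x + p%:R * d) - gnorm x)%Z.
Proof.
move=> p_prime cardK.
have -> : gnorm (x + p%:R * d) =
    fdet (fun g h => coef x (g * h^-1)%g + p%:Z * coef d (g * h^-1)%g).
  by apply: eq_fdet => g h; rewrite coefD -[p%:R]/(p%:Z%:~R) coef_intmul.
have E (g h k : K) : (g * k * (h * k)^-1 = g * h^-1)%g.
  by rewrite invMg mulgA mulgK.
apply: (fdet_add_pmul (to := fun g h => (g * h)%g) p_prime cardK).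
- exact: mulg1.
- exact: mulgA.
- by move=> g h Eg; apply: (mulgI g); rewrite Eg mulg1.
- by move=> g h k; rewrite E.
by move=> g h k; rewrite E.
Qed.

End Norm.

(** * Frobenius modulo p in a commutative ring *)

Section Frobenius.

Variables (R : comNzRingType) (p : nat).
Hypothesis p_prime : prime p.

Definition pcong (x y : R) := exists d, x = y + p%:R * d.

Lemma pcong_refl x : pcong x x. Proof. by exists 0; rewrite mulr0 addr0. Qed.
Lemma pcong_trans x y z : pcong x y -> pcong y z -> pcong x z.
Proof. by move=> [d ->] [e ->]; exists (e + d); rewrite mulrDr addrA. Qed.
Lemma pcongD x y z t : pcong x y -> pcong z t -> pcong (x + z) (y + t).
Proof. by move=> [d ->] [e ->]; exists (d + e); ring. Qed.
Lemma pcongM x y z t : pcong x y -> pcong z t -> pcong (x * z) (y * t).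
Proof. by move=> [d ->] [e ->]; exists (y * e + d * t + p%:R * d * e); ring. Qed.
Lemma pcongX x y n : pcong x y -> pcong (x ^+ n) (y ^+ n).
Proof.
move=> xy; elim: n => [|n IHn]; first exact: pcong_refl.
by rewrite !exprS; exact: pcongM.
Qed.

Lemma pcong_exprD x y : pcong ((x + y) ^+ p) (x ^+ p + y ^+ p).
Proof.
have [q Eq] : exists q, p = q.+1 by exists p.-1; rewrite prednK ?prime_gt0.
rewrite exprDn Eq big_ord_recl big_ord_recr /= bin0 subn0 expr0 mulr1 mulr1n.
rewrite /bump /= add1n subnn expr0 mul1r binn mulr1n.
set mid := \sum_(i < q) _.
suff [d ->] : pcong mid 0 by exists d; rewrite add0r; ring.
apply: (big_ind (fun z => pcong z 0)); first exact: pcong_refl.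
  by move=> u v u0 v0; rewrite -[0]addr0; exact: pcongD.
move=> i _; have : (p %| 'C(q.+1, bump 0 i))%N.
  by rewrite -Eq prime_dvd_bin //= /bump /= add1n Eq !ltnS ltn_ord.
rewrite /bump => /dvdnP[d ->]; rewrite mulrnA -mulr_natl; eexists; rewrite add0r; reflexivity.
Qed.

Lemma pcong_expr_sum n (I : Type) (r : seq I) (F : I -> R) :
  pcong ((\sum_(i <- r) F i) ^+ (p ^ n)) (\sum_(i <- r) F i ^+ (p ^ n)).
Proof.
elim: r => [|i r IHr].
  by rewrite !big_nil expr0n expn_eq0 eqn0Ngt prime_gt0 //=; exact: pcong_refl.
rewrite !big_cons; apply: (@pcong_trans _ (F i ^+ (p ^ n) + (\sum_(i <- r) F i) ^+ (p ^ n))).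
  elim: {IHr} n (F i) (\sum_(i <- r) F i) => [|n IHn] x y; first exact: pcong_refl.
  rewrite expnS !exprM; apply: pcong_trans (IHn _ _).
  by apply: pcongX; exact: pcong_exprD.
by apply: pcongD => //; exact: pcong_refl.
Qed.

End Frobenius.

(** * Units of the group ring modulo the sum of the group *)

Section GeometricSum.
Variable R : comNzRingType.

(** In a group ring the geometric sums of [t] are the source of cyclotomic
    units: [geom t c * geom (t ^+ c) d = geom t (c * d)], and the right hand
    side becomes 1 plus a multiple of [geom t p] when [c * d] is 1 modulo [p]
    and [t ^+ p] acts trivially. *)
Definition geom (t : R) (c : nat) : R := \sum_(i < c) t ^+ i.

Lemma geomS t c : geom t c.+1 = geom t c + t ^+ c.
Proof. by rewrite /geom big_ord_recr. Qed.

Lemma geomD t c d : geom t (c + d) = geom t c + t ^+ c * geom t d.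
Proof.
rewrite /geom big_split_ord mulr_sumr; congr (_ + _).
by apply: eq_bigr => i _; rewrite exprD.
Qed.

Lemma geomM t c d : geom t c * geom (t ^+ c) d = geom t (c * d).
Proof.
elim: d => [|d IHd]; first by rewrite muln0 /geom !big_ord0 mulr0.
by rewrite geomS mulrDr IHd mulnS addnC geomD exprM [_ * geom t c]mulrC.
Qed.

Lemma geom_absorb (s t : R) c : s * t = s -> s * geom t c = c%:R * s.
Proof.
move=> st; rewrite mulr_sumr (eq_bigr (fun=> s)) ?sumr_const ?card_ord ?mulr_natl //.
by move=> i _; elim: (i : nat) => [|k IHk]; rewrite ?mulr1 // exprS mulrA st.
Qed.

Lemma geom_absorb_exp (s t : R) p k : s * t ^+ p = s ->
  s * geom t (1 + p * k) = s * (1 + k%:R * geom t p).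
Proof.
move=> stp; rewrite addnC geomD -geomM mulrDr mulrA.
have -> : s * (t ^+ (p * k) * geom t 1) = s.
  rewrite /geom big_ord1 expr0 mulr1 exprM.
  by elim: k => [|k IHk]; rewrite ?mulr1 // exprS mulrA stp.
by rewrite mulrAC (geom_absorb k stp); ring.
Qed.

End GeometricSum.

Section UnitsModSum.

Variables (K : finGroupType) (KC : commutative (@mulg K)) (p n : nat).
Hypothesis p_prime : prime p.
Hypothesis cardK : #|K| = (p ^ n)%N.
Local Notation A := (group_ring KC).

Lemma dvdz_expr_prime_pow_sub m (u : int) : (p%:Z %| u ^+ (p ^ m) - u)%Z.
Proof.
elim: m => [|m IHm]; first by rewrite expr1 subrr dvdz0.
have := rpredD IHm (dvdz_expr_prime_sub (u ^+ (p ^ m)) p_prime).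
by rewrite expnSr exprM; congr (_ %| _)%Z; ring.
Qed.

(** Frobenius iterated [n] times sends each group element to 1, since the
    exponent of [K] divides [p ^ n]; only the augmentation survives. *)
Lemma expr_card_congr (x : A) (c : int) : (p%:Z %| aug x - c)%Z ->
  exists d, x ^+ #|K| = c%:~R + p%:R * d.
Proof.
move=> dvc; have [d Ed] := pcong_expr_sum p_prime n (index_enum K)
  (fun g => (coef x g)%:~R * gelt KC g).
rewrite -gring_sum_gelt -cardK in Ed.
set s := \sum_g coef x g ^+ #|K|.
have Es : \sum_g ((coef x g)%:~R * gelt KC g) ^+ #|K| = s%:~R :> A.
  rewrite rmorph_sum /=; apply: eq_bigr => g _.
  rewrite exprMn -geltX -cardsT expg_cardG ?inE // gelt1 mulr1 rmorphXn //.
rewrite {}Es in Ed.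
have augE : aug x ^+ #|K| = s + p%:Z * aug d.
  by rewrite -rmorphXn Ed rmorphD rmorphM rmorph_int /= rmorph_nat natz intz.
have /dvdzP[e Ee] : (p%:Z %| s - c)%Z.
  have := rpredB (rpredD (dvdz_expr_prime_pow_sub n (aug x)) dvc) (dvdz_mulr (aug d) (dvdzz p%:Z)).
  by rewrite -cardK augE; congr (_ %| _)%Z; ring.
exists (d + e%:~R); rewrite Ed; have -> : s = c + p%:Z * e by rewrite [_ * e]mulrC -Ee addrC subrK.
by rewrite rmorphD rmorphM /= -pmulrn; ring.
Qed.

(** [C] is the disjoint union of the cosets [C' t ^ i] for [i < p], where [t] is
    any element of [C] outside a subgroup [C'] of index [p]. *)
Lemma index_p_subgroup (C : {group K}) j : #|C| = (p ^ j.+1)%N ->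
  exists C' : {group K}, exists t : K,
    [/\ #|C'| = (p ^ j)%N, (t ^+ p)%g \in C'
      & gsum KC C = gsum KC C' * geom (gelt KC t) p].
Proof.
move=> cardC.
have pC : p.-group%g C by rewrite /pgroup cardC pnatX pnat_id.
have [|C' [sC'C nC'C cardC']] := normal_pgroup (r := j) pC (normal_refl C).
  by rewrite cardC pfactorK.
have cardQ : #|(C / C')%g| = p.
  rewrite card_quotient ?normal_norm // -divgS // cardC cardC' expnS mulnK //.
  by rewrite expn_gt0 prime_gt0.
have [t Ct C't] : exists2 t, t \in C & t \notin C'.
  apply/subsetPn; apply: contraTN isT => /subset_leq_card.
  by rewrite cardC cardC' leq_exp2l ?prime_gt1 // ltnn.
have Nt : t \in 'N(C')%g by exact: (subsetP (normal_norm nC'C)).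
have Qt : coset C' t \in (C / C')%g by exact: mem_quotient.
have ordt : #[coset C' t]%g = p.
  have := order_dvdG Qt; rewrite cardQ => /(primeP p_prime).2 /orP[|/eqP->//].
  by rewrite order_eq1 => /eqP/(coset_idr Nt) tC'; rewrite tC' in C't.
exists C', t; split=> //.
  apply: coset_idr; first exact: groupX.
  by rewrite morphX //= -cardQ expg_cardG.
pose f (u : K * 'I_p) : K := (u.1 * t ^+ u.2)%g.
have inj_f : {in setX C' [set: 'I_p] &, injective f}.
  move=> [c i] [d k]; rewrite !inE !andbT /f /= => Cc Cd E.
  have Eik : i = k.
    have := congr1 (coset C') E.
    have cosE e l : e \in C' -> coset C' (e * t ^+ l)%g = (coset C' t ^+ l)%g.
      move=> Ce; rewrite morphM ?groupX ?(subsetP (normG C') e) //= morphX //=.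
      by rewrite coset_id // mul1g.
    rewrite !cosE //.
    move/eqP; rewrite eq_expg_mod_order ordt !modn_small // => /eqP; exact: val_inj.
  by rewrite Eik in E *; rewrite (mulIg _ _ _ E).
have im_f : f @: setX C' [set: 'I_p] = C.
  apply/eqP; rewrite eqEcard card_in_imset // cardsX cardsT card_ord cardC' cardC expnSr.
  rewrite leqnn andbT.
  apply/subsetP=> g /imsetP[[c i]]; rewrite !inE andbT /= => Cc ->.
  by rewrite groupM ?groupX // (subsetP sC'C).
rewrite /gsum -im_f big_imset //= /geom mulr_suml.
rewrite (eq_bigr (fun u : K * 'I_p => gelt KC u.1 * gelt KC t ^+ u.2)); last first.
  by move=> u _; rewrite geltM geltX.
rewrite (eq_bigl (fun u : K * 'I_p => (u.1 \in C') && true)); last by move=> u; rewrite !inE.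
rewrite -(pair_big (mem C') xpredT (fun c (i : 'I_p) => gelt KC c * gelt KC t ^+ i)) /=.
by apply: eq_bigr => c _; rewrite mulr_sumr.
Qed.

Lemma gsum_absorb (C : {group K}) g : g \in C -> gsum KC C * gelt KC g = gsum KC C.
Proof.
move=> Cg; rewrite /gsum mulr_suml [RHS](reindex_inj (mulIg g)) /=.
by apply: eq_big => [h|h _]; rewrite ?groupMr // geltM.
Qed.

(** Multiplication by [gsum KC C] identifies Z[K/C] with an ideal of Z[K]. So the
    last condition says that the images of [x] and [y] in Z[K/C] are inverse to
    each other modulo the sum of the elements of K/C, and it is expressed
    without the quotient group. *)
Definition unit_pair_at (r : int) (C : {set K}) := exists x y : A, exists k : int,
  [/\ (p%:Z %| aug x - r)%Z, (p%:Z %| aug x * aug y - 1)%Z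
    & gsum KC C * (x * y - 1) = k%:~R * gsum KC setT].

Lemma residue_nat (u : int) : exists c : nat, (p%:Z %| u - c%:Z)%Z.
Proof.
exists `|(u %% p%:Z)%Z|%N; rewrite gez0_abs ?modz_ge0 //.
  by rewrite -eqz_mod_dvd modz_mod.
by have := prime_gt0 p_prime; lia.
Qed.

(** After raising [x] and [y] to the power [#|K|], they have the form [c + p d]
    and [c' + p d'] with natural numbers [c] and [c'] such that [c c'] is 1
    modulo [p]. With [T] the class of the generator [t] of C/C' and
    [tau = 1 + T + ... + T^(p-1)], the new pair is
      [geom T c + tau d],  [geom (T ^+ c) c' + tau d'].
    Where [T] acts as 1, [tau] is [p] and the new pair is the power of the old
    one; where [tau] vanishes, it consists of inverse cyclotomic units. *)
Lemma unit_pair_at_step (r : int) (C : {group K}) j :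
  #|C| = (p ^ j.+1)%N -> unit_pair_at r C ->
  exists2 C' : {group K}, #|C'| = (p ^ j)%N & unit_pair_at r C'.
Proof.
move=> cardC [x [y [k [xr xy1 Exy]]]].
have [C' [t [cardC' C'tp EC]]] := index_p_subgroup cardC.
exists C' => //.
have [c xc] := residue_nat (aug x); have [c' yc'] := residue_nat (aug y).
have [kap Ecc] : exists kap, (c * c' = 1 + p * kap)%N.
  have dvcc : (p%:Z %| (c * c')%N%:Z - 1)%Z.
    have := rpredB xy1 (rpredD (dvdz_mulr (aug y) xc) (dvdz_mulr c%:Z yc')).
    by rewrite PoszM; congr (_ %| _)%Z; ring.
  have cc0 : (0 < c * c')%N.
    case: (c * c')%N dvcc => //; rewrite sub0r rpredN dvdz1 /=.
    by have := prime_gt1 p_prime; lia.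
  have : (p %| c * c' - 1)%N.
    by move: dvcc; rewrite -[1]/(1%:Z) subzn // dvdzE.
  by case/dvdnP=> kap Ek; exists kap; rewrite [(p * _)%N]mulnC -Ek subnKC.
have [d Ed] := expr_card_congr xc; have [d' Ed'] := expr_card_congr yc'.
rewrite -!pmulrn in Ed Ed'.
set s := gsum KC C' in EC *; set T := gelt KC t in EC *; set tau := geom T p in EC *.
have sTp : s * T ^+ p = s by rewrite /T -geltX; exact: gsum_absorb.
have stauT : s * tau * T = s * tau.
  have := geomD T p 1; rewrite addnC geomD /tau.
  rewrite /geom !big_ord1 expr0 expr1 mulr1 -/(geom T p) -/tau => E.
  have -> : s * tau * T = s * (1 + T * tau) - s by ring.
  by rewrite E mulrDr sTp addrK.
have stau_geom m : s * tau * geom T m = m%:R * (s * tau) by exact: geom_absorb.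
have stau_geom' m : s * tau * geom (T ^+ c) m = m%:R * (s * tau).
  apply: geom_absorb; elim: (c) => [|e IHe]; first by rewrite mulr1.
  by rewrite exprS mulrA stauT.
pose u := geom T c; pose v := geom (T ^+ c) c'.
have uv : s * (u * v) = s + kap%:R * (s * tau).
  by rewrite geomM Ecc geom_absorb_exp // -/tau; ring.
(* The product of the new pair differs from 1 by tau E over C', and p E is the
   defect of the old pair. *)
pose E := kap%:R + c%:R * d' + c'%:R * d + p%:R * (d * d').
have main : s * ((u + tau * d) * (v + tau * d') - 1) = s * tau * E.
  have -> : s * ((u + tau * d) * (v + tau * d') - 1) =
    s * (u * v) - s + (s * tau * u) * d' + (s * tau * v) * d + (s * tau * tau) * (d * d') by ring.
  have stautau : s * tau * tau = p%:R * (s * tau) := stau_geom p.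
  by rewrite uv (stau_geom c) (stau_geom' c') stautau /E; ring.
have [w Ew] : exists w, x ^+ #|K| * y ^+ #|K| - 1 = (x * y - 1) * w.
  by exists (\sum_(i < #|K|) (x * y) ^+ i); rewrite -exprMn subrX1.
have pE : p%:R * (s * tau * E) = (k * aug w)%:~R * gsum KC setT.
  rewrite intrM -[RHS]mulrA -mulr_gsumT [w * _]mulrC [RHS]mulrA -Exy EC -/s -[RHS]mulrA -Ew Ed Ed'.
  have : (c%:R * c'%:R : A) = 1 + p%:R * kap%:R by rewrite -!natrM Ecc natrD.
  rewrite /E => Ecc'.
  have -> : s * tau * ((c%:R + p%:R * d) * (c'%:R + p%:R * d') - 1) =
    s * tau * (c%:R * c'%:R - 1 + p%:R * (c%:R * d' + c'%:R * d + p%:R * (d * d'))) by ring.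
  by rewrite Ecc'; ring.
have aug_geom (S : A) m : aug S = 1 -> aug (geom S m) = m%:Z.
  move=> S1; rewrite rmorph_sum /= (eq_bigr (fun=> 1)) ?sumr_const ?card_ord ?natz // => i _.
  by rewrite rmorphXn /= S1 expr1n.
have augx' : aug (u + tau * d) = aug x ^+ (p ^ n).
  rewrite -cardK -rmorphXn Ed !rmorphD !rmorphM !rmorph_nat /= !aug_geom ?natz //; exact: aug_gelt.
have augy' : aug (v + tau * d') = aug y ^+ (p ^ n).
  rewrite -cardK -rmorphXn Ed' !rmorphD !rmorphM !rmorph_nat /= !aug_geom ?natz //.
    exact: aug_gelt.
  by rewrite rmorphXn /= aug_gelt expr1n.
exists (u + tau * d), (v + tau * d'), ((k * aug w)%R %/ p)%Z; split.
- rewrite augx'; have := rpredD (dvdz_expr_prime_pow_sub n (aug x)) xr.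
  by congr (_ %| _)%Z; ring.
- rewrite augx' augy' -exprMn.
  have := rpredD (dvdz_expr_prime_pow_sub n (aug x * aug y)) xy1.
  by congr (_ %| _)%Z; ring.
by rewrite main; exact: gsumT_div pE.
Qed.

(** The descent starts at [C = K], where the last condition only concerns
    augmentations and constants do, and ends at the trivial subgroup. *)
Lemma unit_pair_exists (r r' : int) : (p%:Z %| r * r' - 1)%Z ->
  exists x y : A, exists k : int,
  [/\ (p%:Z %| aug x - r)%Z, (p%:Z %| aug x * aug y - 1)%Z
    & x * y = 1 + k%:~R * gsum KC setT].
Proof.
move=> rr'.
have chain j : (j <= n)%N ->
    exists2 C : {group K}, #|C| = (p ^ (n - j))%N & unit_pair_at r C.
  elim: j => [|j IHj] le_jn.
    exists [group of [set: K]]; first by rewrite /= cardsT cardK subn0.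
    exists r%:~R, r'%:~R, (r * r' - 1); rewrite !rmorph_int !intz; split=> //.
      by rewrite subrr dvdz0.
    by rewrite mulrC rmorphB rmorphM.
  have [C cardC PC] := IHj (ltnW le_jn).
  by apply: (unit_pair_at_step (C := C)) => //; rewrite cardC subnSK.
have [C] := chain n (leqnn n); rewrite subnn expn0 => cardC [x [y [k [xr xy Exy]]]].
exists x, y, k; split=> //; rewrite -Exy.
have -> : gval C = 1%g by apply/eqP; rewrite trivg_card1 cardC.
by rewrite /gsum big_set1 gelt1 mul1r addrC subrK.
Qed.

End UnitsModSum.

(** * The sufficient condition *)

Section Backward.

Variables (K : finGroupType) (KC : commutative (@mulg K)) (p n : nat).
Hypothesis p_prime : prime p.
Hypothesis n_gt0 : (0 < n)%N.
Hypothesis cardK : #|K| = (p ^ n)%N.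
Local Notation A := (group_ring KC).

Lemma gnormX (x : A) m : gnorm (x ^+ m) = gnorm x ^+ m.
Proof.
elim: m => [|m IHm]; last by rewrite !exprS gnormM IHm.
by rewrite !expr0 -[1 in LHS]/(1%:~R) gnorm_int expr1n.
Qed.

(** The power [x ^+ #|K|] is constant modulo [p], and Fermat's little theorem
    removes the exponents from the resulting congruence. *)
Lemma gnorm_aug_mod (x : A) : (p%:Z %| gnorm x - aug x)%Z.
Proof.
have [|d Ed] := @expr_card_congr _ KC _ _ p_prime cardK x (aug x).
  by rewrite subrr dvdz0.
have := gnorm_add_pmul (aug x)%:~R d p_prime cardK.
rewrite -Ed gnormX gnorm_int cardK exprS => dvd.
have := dvdz_trans (dvdz_mulr _ (dvdzz _)) dvd => {}dvd.
have dg := dvdz_expr_prime_pow_sub p_prime n (gnorm x).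
have da := dvdz_expr_prime_pow_sub p_prime n (aug x).
by have := rpredD (rpredB dvd dg) da; congr (_ %| _)%Z; ring.
Qed.

(** Write [gnorm x = M * aug x] and [gnorm y = M' * aug y]. The norm of
    [x * y] is its augmentation [aug x * aug y], so [M * M' = 1]. *)
Lemma gnorm_eq_sign_aug (x y : A) (k : int) :
    x * y = 1 + k%:~R * gsum KC setT -> aug x != 0 -> aug y != 0 ->
  gnorm x = aug x \/ gnorm x = - aug x.
Proof.
move=> xy ax0 ay0.
have /dvdzP[M EM] := aug_dvd_gnorm x; have /dvdzP[M' EM'] := aug_dvd_gnorm y.
have augxy : aug x * aug y = 1 + k * #|K|%:Z.
  by rewrite -rmorphM xy rmorphD rmorphM rmorph_int rmorph1 /= aug_gsum cardsT intz.
have : (M * M') * (aug x * aug y) = 1 * (aug x * aug y).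
  by rewrite mul1r mulrACA -EM -EM' -gnormM xy gnorm_add_gsumT augxy.
move/(mulIf (mulf_neq0 ax0 ay0)) => MM'.
have : (M %| 1)%Z by apply/dvdzP; exists M'; rewrite mulrC MM'.
rewrite EM dvdz1; case: M {EM MM'} => M /= /eqP.
  by move=> ->; left; rewrite mul1r.
by case=> ->; right; rewrite mulN1r.
Qed.

(** The hypothesis says that [q] is its own p-th power modulo [p ^ n], so raising
    to the power [p ^ n] lifts a congruence of [aug x] with [q] modulo [p] to
    one modulo [p ^ n]. *)
Lemma gnorm_represents (q : nat) : (q ^ (p - 1) = 1 %[mod p ^ n])%N ->
  exists x : A, gnorm x = q%:Z.
Proof.
move/eqn_mod_dvdz.
have cardKZ : (p ^ n)%N%:Z = p%:Z ^+ n by rewrite -natz natrX natz.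
rewrite -[(q ^ _)%N%:Z]natz natrX natz => dvq.
have [p2|p_odd] := even_prime p_prime.
  have /dvdzP[k Ek] := dvq; exists (1 + k%:~R * gsum KC setT).
  by rewrite gnorm_add_gsumT cardK -Ek p2 expr1 addrC subrK.
have dvp : (p%:Z %| (p ^ n)%N%:Z)%Z by rewrite cardKZ -[X in (X %| _)%Z]expr1 dvdz_exp2l.
have qq' : (p%:Z %| q%:Z * q%:Z ^+ (p - 2) - 1)%Z.
  by rewrite -exprS subnSK ?prime_gt1 // (dvdz_trans dvp).
have qpow m : ((p ^ n)%N%:Z %| q%:Z ^+ (p ^ m) - q%:Z)%Z.
  elim: m => [|m IHm]; first by rewrite expr1 subrr dvdz0.
  have dvqp : ((p ^ n)%N%:Z %| q%:Z ^+ p - q%:Z)%Z.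
    have -> : q%:Z ^+ p - q%:Z = q%:Z * (q%:Z ^+ (p - 1) - 1).
      by rewrite mulrBr mulr1 -exprS subn1 prednK ?prime_gt0.
    exact: dvdz_mull.
  have : ((p ^ n)%N%:Z %| (q%:Z ^+ (p ^ m)) ^+ p - q%:Z ^+ p)%Z by rewrite subrXX dvdz_mulr.
  move/rpredD/(_ dvqp); rewrite expnSr exprM; by congr (_ %| _)%Z; ring.
have [x [y [k [xq xy1 xyE]]]] := unit_pair_exists KC p_prime cardK qq'.
have /dvdzP[l El] : ((p ^ n)%N%:Z %| q%:Z - aug x ^+ (p ^ n))%Z.
  have := dvdz_exprS_sub n p_prime xq; rewrite exprS -cardKZ.
  move=> /(dvdz_trans (dvdz_mull _ (dvdzz _))).
  move/rpredD/(_ (qpow n)); rewrite -rpredN; by congr (_ %| _)%Z; ring.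
(* Adding a multiple of the sum of the group changes the augmentation by any
   multiple of p ^ n and keeps the product with y2 of the form
   1 + k gsum. *)
pose x2 := x ^+ (p ^ n) + l%:~R * gsum KC setT; pose y2 := y ^+ (p ^ n).
have augx2 : aug x2 = q%:Z.
  by rewrite rmorphD rmorphXn rmorphM rmorph_int /= aug_gsum cardsT cardK intz -El addrC subrK.
have [w Ew] : exists w, x ^+ (p ^ n) * y ^+ (p ^ n) - 1 = (x * y - 1) * w.
  by exists (\sum_(i < p ^ n) (x * y) ^+ i); rewrite -exprMn subrX1.
have x2y2 : x2 * y2 = 1 + (k * aug w + l * aug y2)%:~R * gsum KC setT.
  have -> : x2 * y2 = 1 + (x ^+ (p ^ n) * y ^+ (p ^ n) - 1) + l%:~R * (y2 * gsum KC setT).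
    by rewrite /x2 /y2; ring.
  have -> : x ^+ (p ^ n) * y ^+ (p ^ n) - 1 = (k * aug w)%:~R * gsum KC setT.
    rewrite Ew xyE addrC addKr intrM -[RHS]mulrA -mulr_gsumT; ring.
  by rewrite mulr_gsumT mulrA -intrM intrD; ring.
have augxy2 : q%:Z * aug y2 = 1 + (k * aug w + l * aug y2) * (p ^ n)%N%:Z.
  by rewrite -augx2 -rmorphM x2y2 rmorphD rmorphM rmorph_int rmorph1 /= aug_gsum cardsT cardK intz.
have qy0 : q%:Z * aug y2 != 0.
  apply/eqP=> E0; have : (p%:Z %| q%:Z * aug y2 - (k * aug w + l * aug y2) * (p ^ n)%N%:Z)%Z.
    by rewrite E0 sub0r rpredN dvdz_mull.
  by rewrite augxy2 addrK dvdz1 /=; have := prime_gt1 p_prime; lia.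
have q0 : q%:Z != 0 by apply: contraNneq qy0 => ->; rewrite mul0r.
have ay0 : aug y2 != 0 by apply: contraNneq qy0 => ->; rewrite mulr0.
exists x2; have := gnorm_aug_mod x2.
have := gnorm_eq_sign_aug x2y2; rewrite augx2 => /(_ q0 ay0) [] // ->.
have cpq : coprimez p%:Z q%:Z.
  apply/coprimezP; move: qq' => /dvdzP[e Ee].
  exists (- e, q%:Z ^+ (p - 2)); rewrite /= mulNr -Ee; ring.
have -> : - q%:Z - q%:Z = - (2 * q%:Z) by ring.
rewrite rpredN Gauss_dvdzl // dvdzE /= dvdn_prime2 // => /eqP p2.
by rewrite p2 in p_odd.
Qed.

End Backward.

Lemma abelian_group_det_represents (p n : nat) (gT : finGroupType) (G : {group gT})
    (q : nat) :
    prime p -> (0 < n)%N -> abelian G -> #|G| = (p ^ n)%N ->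
    (q ^ (p - 1) = 1 %[mod p ^ n])%N ->
  is_int_group_det G q%:Z.
Proof.
move=> p_prime n_gt0 abG cardG qp.
have KC : commutative (@mulg (subg_of G)).
  by move=> x y; apply: val_inj; rewrite /=; apply: (centsP abG); exact: subgP.
have cardK : #|{: subg_of G}| = (p ^ n)%N.
  by rewrite card_sub /= -cardG; apply: eq_card => x; rewrite inE.
have [x Ex] := gnorm_represents KC p_prime n_gt0 cardK qp.
exists (fun g => coef x (subg G g)).
rewrite (@group_det_fdet _ _ (fun g => coef x (subg G g)) _ (@sgval _ G)).
- by rewrite -Ex; apply: eq_fdet => g h; rewrite -[(g * h^-1)%g]sgvalK.
- exact: val_inj.
apply/setP=> g; apply/imsetP/idP=> [[h _ ->]|Gg]; first exact: subgP.
by exists (subg G g); rewrite ?subgK.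
Qed.

(** * The theorem *)

Local Open Scope nat_scope.

Theorem theorem1 (p n : nat) (hT : finGroupType) (H : {group hT})
    (p_prime : prime p) (n_ge2 : 2 <= n)
    (H_abelian : abelian H) (card_H : #|H| = p ^ (n - 1)) (q : nat) (q_prime : prime q) :
  is_int_group_det (setX_group (Zp_group p) H) q%:Z <-> q ^ (p - 1) = 1 %[mod p ^ n].
Proof.
split; first exact: group_det_prime_congr.
apply: abelian_group_det_represents => //; first exact: ltnW.
  apply/centsP=> -[i x] /setXP[_ Hx] [j y] /setXP[_ Hy].
  by congr (_, _); [exact: Zp_addC | exact: (centsP H_abelian)].
by rewrite cardsX card_Zp ?prime_gt0 // card_H -expnS subn1 prednK ?(ltnW n_ge2).
Qed.
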